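(* For every prime power $q$, $m(5,q)\leq 6q+5$.
   Context: A $q$-ary linear $[n,k]_q$ code is a $k$-dimensional subspace of $\mathbb{F}_q^n$. The support of a codeword is the set of indices of its nonzero entries. A codeword is minimal if its support contains the support of no other codeword except its scalar multiples; a linear code is minimal if all its codewords are minimal. $m(k,q)$ denotes the smallest length $n$ of a minimal linear $[n,k]_q$ code. *)

(* Defs.v *)
From HB Require Import structures.
From mathcomp Require Import all_boot all_order all_algebra.
From mathcomp Require Import boolp.
Set Implicit Arguments. Unset Strict Implicit. Unset Printing Implicit Defensive.
Import GRing.Theory.
Local Open Scope ring_scope.

Definition supp (F : fieldType) (n : nat) (c : 'rV[F]_n) : {set 'I_n} :=
  [set i | c ord0 i != 0].

(* The zero word is the multiple [0 *: c], so it never prevents a nonzero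
   codeword from being minimal. *)
Definition minimal_codeword (F : fieldType) (n : nat)
    (C : {vspace 'rV[F]_n}) (c : 'rV[F]_n) : Prop :=
  c \in C /\
  forall c', c' \in C -> supp c' \subset supp c -> exists a : F, c' = a *: c.

Definition minimal_code (F : fieldType) (n : nat)
    (C : {vspace 'rV[F]_n}) : Prop :=
  forall c, c \in C -> minimal_codeword C c.

Definition has_minimal_code (F : fieldType) (k n : nat) : Prop :=
  exists C : {vspace 'rV[F]_n}, \dim C = k /\ minimal_code C.

(* Witness: the code of length [#|F| ^ k] whose generator matrix has every
   vector of [F^k] as a column. *)
Lemma has_minimal_code_ex (F : finFieldType) (k : nat) :
  exists n, `[< has_minimal_code F k n >].
Proof.
pose N := #|{: 'rV[F]_k}|.
pose G : 'M[F]_(k, N) := \matrix_(i, j) (enum_val j : 'rV[F]_k) ord0 i.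
pose f : 'Hom('rV[F]_k, 'rV[F]_N) := linfun (mulmxr G).
have fE (u v : 'rV[F]_k) : f u ord0 (enum_rank v) = \sum_i u ord0 i * v ord0 i.
  by rewrite lfunE /= mxE; apply: eq_bigr => i _; rewrite mxE enum_rankK.
have sumd (u : 'rV[F]_k) (i : 'I_k) :
    \sum_l u ord0 l * (delta_mx ord0 i : 'rV[F]_k) ord0 l = u ord0 i.
  rewrite (bigD1 i) //= mxE !eqxx mulr1 big1 ?addr0 // => l /negPf li.
  by rewrite mxE li andbF mulr0.
have f_inj u : f u = 0 -> u = 0.
  move=> fu0; apply/rowP => i.
  by rewrite -[LHS]sumd -fE fu0 !mxE.
exists N; apply/asboolP; exists (limg f); split.
  rewrite limg_dim_eq; first by rewrite dimvf /dim /= mul1n.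
  rewrite capfv; apply/eqP; rewrite -subv0; apply/subvP => u.
  by rewrite memv_ker memv0 => /eqP /f_inj ->.
move=> _ /memv_imgP[u _ ->]; split; first exact: memv_img (memvf u).
move=> _ /memv_imgP[w _ ->] /subsetP sub.
have ortho (v : 'rV[F]_k) :
    \sum_i u ord0 i * v ord0 i = 0 -> \sum_i w ord0 i * v ord0 i = 0.
  rewrite -(fE u v) -(fE w v) => uv0; apply/eqP; apply/negPn/negP => wv.
  by have := sub (enum_rank v); rewrite !inE uv0 eqxx => /(_ wv).
have [u0|/rV0Pn[i ui]] := eqVneq u 0.
  exists 0; rewrite scale0r (_ : w = 0) ?linear0 //; apply/rowP => j.
  rewrite -[LHS]sumd [RHS]mxE; apply: ortho.
  by rewrite u0 big1 // => l _; rewrite mxE mul0r.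
exists (w ord0 i / u ord0 i); rewrite -linearZ; congr (f _).
apply/rowP => j; rewrite mxE.
pose v : 'rV[F]_k := u ord0 i *: delta_mx ord0 j - u ord0 j *: delta_mx ord0 i.
have sumv (x : 'rV[F]_k) : \sum_l x ord0 l * v ord0 l
    = u ord0 i * x ord0 j - u ord0 j * x ord0 i.
  rewrite -[x ord0 j]sumd -[x ord0 i]sumd !mulr_sumr -sumrB.
  apply: eq_bigr => l _; rewrite !mxE mulrBr.
  by rewrite !(mulrCA (x ord0 l)).
have := ortho v; rewrite !sumv [X in X - _]mulrC subrr => /(_ erefl)/eqP.
rewrite subr_eq0 => /eqP uw.
by apply: (mulfI ui); rewrite uw mulrA [u _ i * _]mulrC divfK // mulrC.
Qed.

(* The smallest length of a minimal [n,k] code over [F]: this is m(k,q) for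
   [F] the field with [q] elements. *)
Definition m (k : nat) (F : finFieldType) : nat :=
  ex_minn (has_minimal_code_ex F k).

(* Main.v *)
Require Import Defs.
From HB Require Import structures.
From mathcomp Require Import all_boot all_order all_algebra.
From mathcomp Require Import ring zify.
From mathcomp Require Import boolp.

(* A code is minimal as soon as the columns of a generator matrix form a strong
   blocking set; for a union of lines of PG(4,q) it suffices that no plane meets
   all the lines. Six lines impose six linear equations on the Pluecker
   coordinates of a plane, and the Grassmannian G(2,5) has degree 5, so over an
   algebraically closed field five planes always meet all of them. If two of the
   lines meet, these five split into the two through the common point and three
   others; for q > 2 the lines below are chosen such that the two are given by a
   quadratic, and the three by a cubic, without root in F_q. The
   common point brings the number of points down to 6(q+1)-1. For q = 2 the ten
   edges of a simplex have 15 points. *)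
Set Implicit Arguments. Unset Strict Implicit. Unset Printing Implicit Defensive.
Import GRing.Theory.
Local Open Scope ring_scope.

(** * Minimal codes from strong blocking sets *)

Section Dot.
Variables (F : fieldType) (k : nat).
Implicit Types u v w : 'rV[F]_k.

Definition dot u v : F := (u *m v^T) 0 0.

Lemma dotDr u v w : dot u (v + w) = dot u v + dot u w.
Proof. by rewrite /dot linearD mulmxDr mxE. Qed.

Lemma dotZr u a v : dot u (a *: v) = a * dot u v.
Proof. by rewrite /dot linearZ -scalemxAr mxE. Qed.

Lemma dotNr u v : dot u (- v) = - dot u v.
Proof. by rewrite -scaleN1r dotZr mulN1r. Qed.

Lemma dot0l v : dot 0 v = 0.
Proof. by rewrite /dot mul0mx mxE. Qed.

Lemma dot_delta u i : dot u (delta_mx 0 i) = u 0 i.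
Proof. by rewrite /dot trmx_delta -colE mxE. Qed.

Definition zeros_incl (s : seq 'rV[F]_k) u w :=
  forall v, v \in s -> dot u v = 0 -> dot w v = 0.

(* The 2 x 2 minors are the Pluecker coordinates of the codimension 2 subspace
   [u = w = 0]. *)
Definition strong_blocking (s : seq 'rV[F]_k) :=
  forall u w, zeros_incl s u w ->
  forall i j, u 0 i * w 0 j - u 0 j * w 0 i = 0.

(* If [u = 0], then [w] vanishes on all of [s], so that its minors with every
   unit vector are zero as well. *)
Lemma strong_blocking_scale s u w : (1 < k)%N -> strong_blocking s ->
  zeros_incl s u w -> exists a, w = a *: u.
Proof.
move=> k_gt1 sb uw; have minor0 := sb _ _ uw.
have [u0|/rV0Pn[i ui]] := eqVneq u 0; last first.
  exists (w 0 i / u 0 i); apply/rowP => j; rewrite mxE.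
  have /eqP := minor0 i j; rewrite subr_eq0 => /eqP e.
  by apply: (mulfI ui); rewrite e mulrA [u 0 i * _]mulrC divfK // mulrC.
exists 0; rewrite scale0r; apply/rowP => j; rewrite mxE.
have [i neq_ij] : exists i : 'I_k, i != j.
  case: (posnP j) => [j0|j_gt0].
    by exists (Ordinal k_gt1); rewrite -val_eqE /= j0.
  by exists (Ordinal (ltnW k_gt1)); rewrite -val_eqE /= eq_sym -lt0n.
have ew : zeros_incl s (delta_mx 0 i) w.
  by move=> v sv _; apply: uw => //; rewrite u0 dot0l.
have := sb _ _ ew i j; rewrite !mxE !eqxx eq_sym (negPf neq_ij) mul1r mul0r.
by rewrite subr0.
Qed.

End Dot.

(** With the vectors of [s] as columns of a generator matrix, inclusion of supports is reverse
    inclusion of zeros, that is [zeros_incl]. Comparison with the zero word shows that the encoding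
    is injective. *)
Lemma has_minimal_code_of_strong_blocking (F : finFieldType) (k : nat)
    (s : seq 'rV[F]_k) :
  (1 < k)%N -> strong_blocking s -> has_minimal_code F k (size s).
Proof.
move=> k_gt1 sb.
pose G : 'M[F]_(k, size s) := \matrix_(i, j) (nth 0 s j) 0 i.
pose f : 'Hom('rV[F]_k, 'rV[F]_(size s)) := linfun (mulmxr G).
have fE u i : f u 0 i = dot u (nth 0 s i).
  by rewrite lfunE /= /dot !mxE; apply: eq_bigr => l _; rewrite !mxE.
have f_incl u w : supp (f w) \subset supp (f u) -> exists a, w = a *: u.
  move=> /subsetP sub; apply: (strong_blocking_scale k_gt1 sb) => v sv uv0.
  rewrite -index_mem in sv; apply/eqP/negPn/negP => wv.
  have := sub (Ordinal sv); rewrite !inE !fE /= nth_index -?index_mem //.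
  by rewrite uv0 eqxx => /(_ wv).
have f_inj u : f u = 0 -> u = 0.
  move=> fu0; have [|a ->] := f_incl 0 u; last by rewrite scaler0.
  by rewrite fu0 linear0.
exists (limg f); split.
  rewrite limg_dim_eq; first by rewrite dimvf /dim /= mul1n.
  rewrite capfv; apply/eqP; rewrite -subv0; apply/subvP => u.
  by rewrite memv_ker memv0 => /eqP /f_inj ->.
move=> _ /memv_imgP[u _ ->]; split; first exact: memv_img (memvf u).
move=> _ /memv_imgP[w _ ->] /f_incl[a ->]; exists a; exact: linearZ.
Qed.

Lemma m_le_strong_blocking (F : finFieldType) (k : nat) (s : seq 'rV[F]_k) :
  (1 < k)%N -> strong_blocking s -> (m k F <= size s)%N.
Proof.
move=> k_gt1 sb; rewrite /m; case: ex_minnP => n _; apply.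
exact/asboolP/has_minimal_code_of_strong_blocking.
Qed.

(** * Lines and the equations they impose *)

Section Lines.
Variables (F : finFieldType) (k : nat).
Implicit Types (a b u w : 'rV[F]_k) (s : seq 'rV[F]_k).

(** The point [a] is left out so that lines through it can share it. *)
Definition affine_line a b := [seq b + t *: a | t <- enum F].

Definition proj_line a b := a :: affine_line a b.

Lemma size_affine_line a b : size (affine_line a b) = #|F|.
Proof. by rewrite size_map -cardE. Qed.

Lemma size_proj_line a b : size (proj_line a b) = #|F|.+1.
Proof. by rewrite /= size_affine_line. Qed.

Lemma zeros_incl_sub s s' u w :
  {subset s <= s'} -> zeros_incl s' u w -> zeros_incl s u w.
Proof. by move=> ss' uw v /ss'; apply: uw. Qed.

(** The form [u] vanishes at some point of the line, where [w] then vanishes too; so their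
    restrictions to the line are dependent. *)
Lemma proj_line_minor a b u w : zeros_incl (proj_line a b) u w ->
  dot u a * dot w b - dot u b * dot w a = 0.
Proof.
move=> uw; have [ua0|ua] := eqVneq (dot u a) 0.
  by rewrite (uw a) ?mem_head // ua0 mul0r mulr0 subrr.
pose t := - (dot u b / dot u a).
have /uw : b + t *: a \in proj_line a b.
  by rewrite inE; apply/orP; right; apply: map_f; rewrite mem_enum.
rewrite !dotDr !dotZr /t mulNr divfK // subrr => /(_ erefl) e.
have -> : dot w b = dot u b / dot u a * dot w a.
  by apply/eqP; rewrite -subr_eq0 -mulNr e.
by field.
Qed.

End Lines.

(** A self-map of a finite set that is not injective is not surjective. This supplies [c] and [d] in
    every characteristic, as [t ^+ 3 - t ^+ 2] and [t ^+ 2 - t] both vanish at 0 and 1. *)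
Lemma exists_not_in_image (T : finType) (f : T -> T) (x y : T) :
  x != y -> f x = f y -> exists z, forall t, f t != z.
Proof.
move=> neq_xy fxy.
suff /existsP[z /forallP] : [exists z, forall t, f t != z] by exists z.
apply: contraR neq_xy => /existsPn surj.
have f_onto z : z \in codom f.
  have := surj z; rewrite negb_forall => /existsP[t].
  by rewrite negbK => /eqP <-; apply: codom_f.
have /injectiveP f_inj : injectiveb f.
  apply/card_uniqP; rewrite size_codom; apply: eq_card => z.
  by rewrite f_onto.
by rewrite (f_inj _ _ fxy).
Qed.

(** * Solving the six equations *)

Section Pluecker.
Variable F : fieldType.

Definition minor (u w : nat -> F) (i j : nat) := u i * w j - u j * w i.

Lemma pluecker_relation u w i j k l :
  minor u w i j * minor u w k l - minor u w i k * minor u w j l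
  + minor u w i l * minor u w j k = 0.
Proof. by rewrite /minor; ring. Qed.

(* In [F^5], the conditions [p01 = p02 = 0] leave two families of codimension 2
   subspaces, those with [p12 = 0] and those with [p03 = p04 = 0]; in the first
   the Pluecker relations turn the equations into a cubic in [p04 / p03], in
   the second into a quadratic in [p14 / p12]. *)
Lemma pluecker_eq0 (c d : F) (u w : nat -> F) :
    (forall t, t ^+ 3 - t ^+ 2 != c) -> (forall t, t ^+ 2 - t != d) ->
    minor u w 0 1 = 0 -> minor u w 0 2 = 0 -> minor u w 3 4 = 0 ->
    minor u w 1 3 + minor u w 0 4 - d * minor u w 1 2 = 0 ->
    minor u w 1 4 + minor u w 2 3 + minor u w 0 4 - minor u w 1 2 = 0 ->
    minor u w 2 4 - c * minor u w 0 3 + minor u w 1 2 = 0 ->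
  [/\ minor u w 0 3 = 0, minor u w 0 4 = 0, minor u w 1 2 = 0
    & minor u w 1 3 = 0]
  /\ [/\ minor u w 1 4 = 0, minor u w 2 3 = 0 & minor u w 2 4 = 0].
Proof.
move=> cubic quadratic.
have R0123 := pluecker_relation u w 0 1 2 3.
have R0124 := pluecker_relation u w 0 1 2 4.
have R0134 := pluecker_relation u w 0 1 3 4.
have R0234 := pluecker_relation u w 0 2 3 4.
have R1234 := pluecker_relation u w 1 2 3 4.
move: R0123 R0124 R0134 R0234 R1234.
move: (minor u w 0 1) (minor u w 0 2) (minor u w 0 3) (minor u w 0 4)
  (minor u w 1 2) (minor u w 1 3) (minor u w 1 4) (minor u w 2 3)
  (minor u w 2 4) (minor u w 3 4) => p01 p02 x y z p13 p14 p23 p24 p34 + + + + + e01 e02 e34.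
rewrite {}e01 {}e02 {}e34 !(mul0r, mulr0, subrr, sub0r, oppr0, add0r).
move=> xz yz R0134 R0234 R1234 eA eB eC.
have {eA} eA : p13 = d * z - y by apply/eqP; rewrite -subr_eq0 -eA; apply/eqP; ring.
have {eB} eB : p23 = z - y - p14 by apply/eqP; rewrite -subr_eq0 -eB; apply/eqP; ring.
have {eC} eC : p24 = c * x - z by apply/eqP; rewrite -subr_eq0 -eC; apply/eqP; ring.
have [z0|z_neq0] := eqVneq z 0; last first.
  have x0 : x = 0 by apply/eqP; move/eqP: xz; rewrite mulf_eq0 (negPf z_neq0) orbF.
  have y0 : y = 0 by apply/eqP; move/eqP: yz; rewrite mulf_eq0 (negPf z_neq0) orbF.
  case/eqP: (quadratic (p14 / z)); apply/eqP; rewrite -subr_eq0.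
  have -> : (p14 / z) ^+ 2 - p14 / z - d =
      - (z ^+ 2)^-1 * (- (p13 * p24) + p14 * p23).
    by rewrite eA eB eC x0 y0; field.
  by rewrite R1234 mulr0.
have x0 : x = 0.
  apply/eqP; apply: contraT => x_neq0.
  case/eqP: (cubic (y / x)); apply/eqP; rewrite -subr_eq0.
  (* This combination of two Pluecker relations eliminates [p14]. *)
  have -> : (y / x) ^+ 3 - (y / x) ^+ 2 - c =
      - (x ^+ 3)^-1 * (y * (- (x * p14) + y * p13) + - x * (- (x * p24) + y * p23) ).
    by rewrite eA eB eC z0; field.
  by rewrite R0134 R0234 !mulr0 addr0 mulr0.
have y0 : y = 0.
  move: R0134; rewrite eA z0 x0 mul0r mulr0 oppr0 add0r sub0r mulrN => /eqP.
  by rewrite oppr_eq0 mulf_eq0 orbb => /eqP.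
have p140 : p14 = 0.
  move: R1234; rewrite eA eB eC x0 y0 z0 !(mulr0, mul0r, subr0, oppr0, sub0r, add0r).
  by rewrite mulrN => /eqP; rewrite oppr_eq0 mulf_eq0 orbb => /eqP.
by rewrite eA eB eC x0 y0 z0 p140 !mulr0 !subr0.
Qed.

End Pluecker.

Section Blocking5.
Variable F : fieldType.

Definition unit5 (i : nat) : 'rV[F]_5 := delta_mx 0 (inord i).

Definition coord5 (u : 'rV[F]_5) (i : nat) : F := u 0 (inord i).

Lemma dot_unit5 u i : dot u (unit5 i) = coord5 u i.
Proof. exact: dot_delta. Qed.

Lemma strong_blocking5 (s : seq 'rV[F]_5) :
    (forall u w, zeros_incl s u w -> forall i j, (i < j < 5)%N ->
     minor (coord5 u) (coord5 w) i j = 0) ->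
  strong_blocking s.
Proof.
move=> sb u w /sb minor0 i j; rewrite -[i]inord_val -[j]inord_val.
have [ij|ji|->] := ltngtP i j; last exact: subrr.
  by apply: minor0; rewrite ij /=.
apply/eqP; rewrite subr_eq0 eq_sym -subr_eq0; apply/eqP.
by apply: minor0; rewrite ji /=.
Qed.

End Blocking5.

Local Notation "''b_' i" := (unit5 _ i) (at level 8, i at level 2).

(** * The two blocking sets *)

Section Constructions5.
Variable F : finFieldType.

Definition tetrahedron5 : seq 'rV[F]_5 :=
  [seq 'b_i | i <- iota 0 5] ++
  [seq 'b_j + 'b_i | j <- iota 0 5, i <- iota 0 j].

(** Over two elements the edge through ['b_i] and ['b_j] has only these points and their sum, so
    each coordinate minor vanishes. *)
Lemma tetrahedron5_strong_blocking : #|F| = 2 -> strong_blocking tetrahedron5.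
Proof.
move=> F2; have F01 (t : F) : t = 0 \/ t = 1.
  have /subset_cardP : #|[set 0; 1 : F]| = #|{: F}|.
    by rewrite cards2 eq_sym oner_neq0 F2.
  move=> /(_ (subset_predT _)) /(_ t); rewrite !inE.
  by case/orP => /eqP; [left | right].
apply: strong_blocking5 => u w uw i j /andP[ij j5].
rewrite /minor -!dot_unit5; apply: proj_line_minor.
apply: zeros_incl_sub uw => v; rewrite inE => /predU1P[->|/mapP[t _ ->]].
  by rewrite mem_cat map_f // mem_iota (ltn_trans ij).
case: (F01 t) => ->; rewrite ?scale0r ?scale1r ?addr0 mem_cat.
  by rewrite map_f // mem_iota.
apply/orP; right; apply/allpairsPdep; exists j, i; split=> //.
  by rewrite mem_iota.
by rewrite mem_iota.
Qed.

Lemma size_tetrahedron5 : size tetrahedron5 = 15.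
Proof. by rewrite size_cat size_map size_allpairs_dep. Qed.

(* The last three lines are, up to scaling, spanned by [f1 - Q / s] and
   [s f2 + P], where [P = a b3 + b b4], [Q = b b3 + g b4], [s = g - b - d a],
   [f1 = b1 + m b0] and [f2 = b2 + n b0] with
   [m P + n Q = (a + b) b4 - c g b3], for
   [(a, b, g) = (0, 1, 0), (0, 1, r), (1, 0, r d)]. The exterior product of the
   two spanning vectors is [s f1 ^ f2 + f1 ^ P + f2 ^ Q] modulo [b3 ^ b4], so
   each line yields the combination with coefficients [a, b, g] of the last
   three hypotheses of [pluecker_eq0]. *)
Definition six_lines (c d r : F) : seq 'rV[F]_5 :=
  let g := r * d in let s := r - 1 in let s' := g - d in
  'b_0 :: affine_line 'b_0 'b_1 ++ affine_line 'b_0 'b_2 ++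
  proj_line 'b_3 'b_4 ++
  proj_line ('b_1 + 'b_0 + 'b_3) ('b_4 - 'b_2) ++
  proj_line (s *: ('b_1 + (1 + c * r ^+ 2) *: 'b_0) - ('b_3 + r *: 'b_4))
    (s *: ('b_2 - (c * r) *: 'b_0) + 'b_4) ++
  proj_line (s' *: ('b_1 - (c * g) *: 'b_0) - g *: 'b_4)
    (s' *: (g *: 'b_2 + 'b_0) + g *: 'b_3).

(** The shared point, two lines without it and four full lines: 1 + 2q + 4(q + 1). *)
Lemma size_six_lines c d r : size (six_lines c d r) = (6 * #|F| + 5)%N.
Proof.
rewrite /six_lines -cat1s !size_cat !size_proj_line !size_affine_line /=; lia.
Qed.

Lemma six_lines_strong_blocking c d r :
    (forall t, t ^+ 3 - t ^+ 2 != c) -> (forall t, t ^+ 2 - t != d) ->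
    r != 0 -> r != 1 ->
  strong_blocking (six_lines c d r).
Proof.
move=> cubic quadratic r_neq0 r_neq1; apply: strong_blocking5 => u w uw.
pose U := coord5 u; pose W := coord5 w.
have d_neq0 : d != 0 by have := quadratic 0; rewrite expr0n subr0 eq_sym.
pose s := r - 1; pose g := r * d; pose s' := g - d.
have s_neq0 : s != 0 by rewrite subr_eq0.
have g_neq0 : g != 0 by rewrite mulf_neq0.
have line a b : {subset proj_line a b <= six_lines c d r} ->
    dot u a * dot w b - dot u b * dot w a = 0.
  by move=> /zeros_incl_sub/(_ uw)/proj_line_minor.
have s'_neq0 : s' != 0.
  by rewrite (_ : s' = s * d) ?mulf_neq0 // /s' /g /s; ring.
have p01 : minor U W 0 1 = 0.
  rewrite /minor /U /W -!dot_unit5; apply: line => v; rewrite /six_lines.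
  by rewrite !inE !mem_cat => /orP[]->; rewrite ?orbT.
have p02 : minor U W 0 2 = 0.
  rewrite /minor /U /W -!dot_unit5; apply: line => v; rewrite /six_lines.
  by rewrite !inE !mem_cat => /orP[]->; rewrite ?orbT.
have p34 : minor U W 3 4 = 0.
  rewrite /minor /U /W -!dot_unit5; apply: line => v vl.
  by rewrite /six_lines in_cons !mem_cat vl !orbT.
pose D a b := dot u a * dot w b - dot u b * dot w a.
have eB : minor U W 1 4 + minor U W 2 3 + minor U W 0 4 - minor U W 1 2 = 0.
  transitivity (D ('b_1 + 'b_0 + 'b_3) ('b_4 - 'b_2)
      + minor U W 0 2 - minor U W 3 4).
    by rewrite /D !(dotDr, dotNr, dot_unit5) /minor /U /W; ring.
  rewrite p02 p34 subr0 addr0; apply: line => v vl.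
  by rewrite /six_lines in_cons !mem_cat vl !orbT.
have eC : minor U W 2 4 - c * minor U W 0 3 + minor U W 1 2 = 0.
  (* The line gives [eB] plus [r] times [eC], scaled by [s]; removing [eB] leaves the factor
     [s * r]. *)
  apply: (mulfI r_neq0); apply: (mulfI s_neq0); rewrite !mulr0.
  transitivity (D (s *: ('b_1 + (1 + c * r ^+ 2) *: 'b_0) - ('b_3 + r *: 'b_4))
      (s *: ('b_2 - (c * r) *: 'b_0) + 'b_4)
      - s * (minor U W 1 4 + minor U W 2 3 + minor U W 0 4 - minor U W 1 2)
      - s ^+ 2 * (c * r * minor U W 0 1 + (1 + c * r ^+ 2) * minor U W 0 2)
      + minor U W 3 4).
    by rewrite /D /s !(dotDr, dotNr, dotZr, dot_unit5) /minor /U /W; ring.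
  rewrite eB p01 p02 p34 !(mulr0, addr0, subr0).
  apply: line => v vl.
  by rewrite /six_lines in_cons !mem_cat vl !orbT.
have eA : minor U W 1 3 + minor U W 0 4 - d * minor U W 1 2 = 0.
  (* Likewise the last line gives [eA] plus [g] times [eC], scaled by [s' * g]. *)
  apply: (mulfI g_neq0); apply: (mulfI s'_neq0); rewrite !mulr0.
  transitivity (D (s' *: ('b_1 - (c * g) *: 'b_0) - g *: 'b_4)
      (s' *: (g *: 'b_2 + 'b_0) + g *: 'b_3)
      - s' * g ^+ 2 * (minor U W 2 4 - c * minor U W 0 3 + minor U W 1 2)
      + s' ^+ 2 * (minor U W 0 1 + c * g ^+ 2 * minor U W 0 2)
      - g ^+ 2 * minor U W 3 4).
    by rewrite /D /s' !(dotDr, dotNr, dotZr, dot_unit5) /minor /U /W; ring.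
  rewrite eC p01 p02 p34 !(mulr0, addr0, subr0).
  apply: line => v vl.
  by rewrite /six_lines in_cons !mem_cat vl !orbT.
have [[p03 p04 p12 p13] [p14 p23 p24]] :=
  pluecker_eq0 cubic quadratic p01 p02 p34 eA eB eC.
by case=> [|[|[|[|i]]]] [|[|[|[|[|j]]]]] // ij; lia.
Qed.

End Constructions5.

Local Close Scope ring_scope.

Theorem mainTheorem8 (p e : nat) (hp : prime p) (he : 0 < e) (q : nat)
    (hq : q = p ^ e) (F : finFieldType) (hF : #|F| = q) :
  m 5 F <= 6 * q + 5.
Proof.
(* The six lines need some [r] other than 0 and 1, so q = 2 is separate; there 15 is below 17. *)
have [q_gt2|q_le2] := ltnP 2 q; last first.
  have F2 : #|F| = 2 by have := card_finNzRing_gt1 F; rewrite hF; lia.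
  rewrite (leq_trans (m_le_strong_blocking _ (tetrahedron5_strong_blocking F2))) //.
  by rewrite size_tetrahedron5 -hF F2.
have [c cubic] : exists c : F, forall t, (t ^+ 3 - t ^+ 2 != c)%R.
  apply: (@exists_not_in_image _ _ 0%R 1%R); first by rewrite eq_sym oner_neq0.
  by rewrite !expr0n !expr1n !subrr.
have [d quadratic] : exists d : F, forall t, (t ^+ 2 - t != d)%R.
  apply: (@exists_not_in_image _ _ 0%R 1%R); first by rewrite eq_sym oner_neq0.
  by rewrite !expr0n !expr1n !subrr.
have [r] : exists r : F, r \notin [set 0%R; 1%R].
  apply/existsP; rewrite -negb_forall; apply/negP => /forallP all01.
  have : #|F| <= #|[set 0%R; 1%R : F]|.
    by apply: subset_leq_card; apply/subsetP => r _; apply: all01.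
  by rewrite cards2 eq_sym oner_neq0 hF leqNgt q_gt2.
rewrite !inE negb_or => /andP[r_neq0 r_neq1].
rewrite -hF -(size_six_lines c d r).
exact/m_le_strong_blocking/six_lines_strong_blocking.
Qed.
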